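(* Let $d=1$, $K>0$, $R>0$. Suppose there are positive constants $L_{K,R},\rho_1,\rho_2$, independent of the discretization parameters $h=(\Delta t,\Delta x)$, such that for every admissible $h$, $$\mu_0\Big(\big|\mathrm{lin}^R[\hat\lambda^{h,R}_0]-\lambda^R_0\mathbf{1}_{O_R}\big|\Big)\le L_{K,R}\big(\Delta t^{\rho_1}+\Delta x^{\rho_2}\big)\qquad\text{for all }\lambda_1\in\mathrm{Lip}^0_K\text{ and }\hat\lambda_1=\lambda_1|_{\mathcal{N}_R}.$$ Then, with these constants, $$\big|V^{K,R}_h-V^{K,R}\big|\le L_{K,R}\big(\Delta t^{\rho_1}+\Delta x^{\rho_2}\big)+K\Delta x.$$
   Context: Setting: $d=1$, $\mu_0,\mu_1$ probability measures on $\mathbb{R}$; $U\subset[0,\infty)\times\mathbb{R}$ is compact and convex; $\ell:[0,1]\times\mathbb{R}\times U\to\mathbb{R}^+$ is nonnegative, continuous, convex in $u=(a,b)\in U$ and Lipschitz in $x$ uniformly in $(t,u)$. $\mu(\phi)=\int\phi\,d\mu$, $O_R=(-R,R)$. Continuous problem. $\Omega=C([0,1],\mathbb{R})$, $X$ canonical process, $\mathbb{F}$ its filtration. $\mathcal{P}_{t,x}$ is the set of probability measures $\mathbb{P}$ on $\Omega$ such that $\mathbb{P}[X_s=x,0\le s\le t]=1$ and on $[t,1]$ $X$ is a continuous semimartingale whose finite variation part is $\int_t^\cdot\beta^{\mathbb{P}}_sds$ and whose martingale part has quadratic variation $\int_t^\cdot\alpha^{\mathbb{P}}_sds$, with $\nu^{\mathbb{P}}=(\alpha^{\mathbb{P}},\beta^{\mathbb{P}})$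 progressive and $U$-valued $d\mathbb{P}\times ds$-a.e. on $[t,1]$. With $\tau_R:=\inf\{t:X_t\notin O_R\}$, $$\lambda^R(t,x):=\inf_{\mathbb{P}\in\mathcal{P}_{t,x}}\mathbb{E}^{\mathbb{P}}\Big[\int_t^{\tau_R\wedge1}\ell(s,X_s,\nu^{\mathbb{P}}_s)ds+\lambda_1(X_{\tau_R\wedge1})\Big],\qquad \lambda^R_0:=\lambda^R(0,\cdot).$$ $\mathrm{Lip}^0_K$ is the set of bounded $K$-Lipschitz functions $\phi:\mathbb{R}\to\mathbb{R}$ with $\phi(0)=0$, and $$V^{K,R}:=\sup_{\lambda_1\in\mathrm{Lip}^0_K}\big\{\mu_0(\lambda^R_0\mathbf{1}_{O_R})-\mu_1(\lambda_1\mathbf{1}_{O_R})\big\}.$$ Discrete problem. Let $l,r\in\mathbb{N}$, $h=(\Delta t,\Delta x)$ with $l\Delta t=1$, $r\Delta x=R$; $t_k=k\Delta t$, $x_i=i\Delta x$; $\mathcal{N}_R=\{x_i:-r\le i\le r\}$. $h$ is admissible if in addition the CFL condition $\Delta t\big(\frac{|b|}{\Delta x}+\frac{|a|}{\Delta x^2}\big)\le1$ holds for all $(a,b)\in U$. For $w$ on the space-time grid: $D^{\pm}w(t_k,x_i)=\frac{w(t_k,x_{i\pm1})-w(t_k,x_i)}{\Delta x}$, $(bD)w=b^+D^+w+b^-D^-w$ with $b^+=\max(0,b)$, $b^-=\max(0,-b)$, and $D^2w(t_k,x_i)=\frac{w(t_k,x_{i+1})-2w(t_k,x_i)+w(t_k,x_{i-1})}{\Delta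 x^2}$. Given $\hat\lambda_1:\mathcal{N}_R\to\mathbb{R}$, $\hat\lambda^{h,R}$ is defined by $\hat\lambda^{h,R}(t_k,x_i)=\hat\lambda_1(x_i)$ if $k=l$ or $i=\pm r$, and for $0\le k<l$, $-r<i<r$, $$\hat\lambda^{h,R}(t_k,x_i)=\Big(\hat\lambda^{h,R}+\Delta t\inf_{u=(a,b)\in U}\Big\{\ell(\cdot,u)+(bD)\hat\lambda^{h,R}+\tfrac12aD^2\hat\lambda^{h,R}\Big\}\Big)(t_{k+1},x_i);$$ $\hat\lambda^{h,R}_0:=\hat\lambda^{h,R}(0,\cdot)$. For $\phi:\mathcal{N}_R\to\mathbb{R}$, $\mathrm{lin}^R[\phi]$ is the piecewise linear interpolation of $\phi$ on $O_R$, extended by zero outside $O_R$. $\mathrm{Lip}^{K,R}_0:=\{\lambda_1|_{\mathcal{N}_R}:\lambda_1\in\mathrm{Lip}^0_K\}$ and $$V^{K,R}_h:=\sup_{\hat\lambda_1\in\mathrm{Lip}^{K,R}_0}\big\{\mu_0(\mathrm{lin}^R[\hat\lambda^{h,R}_0])-\mu_1(\mathrm{lin}^R[\hat\lambda_1])\big\}.$$ *)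

(* Defs.v *)
From HB Require Import structures.
From mathcomp Require Import all_boot all_order all_algebra.
From mathcomp Require Import all_classical all_reals all_analysis.

Set Implicit Arguments.
Unset Strict Implicit.
Unset Printing Implicit Defensive.

Import Order.TTheory GRing.Theory Num.Theory.
Import numFieldNormedType.Exports.

Local Open Scope classical_set_scope.
Local Open Scope ring_scope.

(* Controls are pairs u = (a, b): u.1 is the diffusion coefficient (the density
   of the quadratic variation) and u.2 the drift. *)

Definition control_set (R : realType) (U : set (R * R)) : Prop :=
  [/\ compact U,
      convex_set (U : set (convex_lmodType (R^o * R^o)%type)) &
      forall u, U u -> 0 <= u.1].

(* The cost is a total function, constrained on [0, 1] x R x U only. *)
Definition running_cost (R : realType) (U : set (R * R))
    (ell : R -> R -> R * R -> R) : Prop :=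
  [/\ forall t x u, 0 <= t <= 1 -> U u -> 0 <= ell t x u,
      {within `[0, 1] `*` setT `*` U,
        continuous (fun z : R * R * (R * R) => ell z.1.1 z.1.2 z.2)},
      forall t x, 0 <= t <= 1 ->
        convex_function (U : set (convex_lmodType (R^o * R^o)%type)) (ell t x) &
      exists C : R, forall t u x y, 0 <= t <= 1 -> U u ->
        `|ell t x u - ell t y u| <= C * `|x - y| ].

Definition Lip0 (R : realType) (K : R) : set (R -> R) :=
  [set phi | [/\ [bounded phi x | x in setT],
                 forall x y, `|phi x - phi y| <= K * `|x - y| &
                 phi 0 = 0]].

Definition open_ball0 (R : realType) (Rad : R) : set R := `]- Rad, Rad[.

Definition cpath (R : realType) : Type :=
  continuousType (set_type (`[(0 : R), 1]%classic : set R)) R.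

HB.instance Definition _ (R : realType) := Choice.on (cpath R).
HB.instance Definition _ (R : realType) :=
  isPointed.Build (cpath R) (mkcts (fun x => @cst_continuous _ _ (0 : R) x)).

(* The time index ranges over all of R so as to write s, t as real numbers; only
   times in [0, 1] are ever used (the path is read as 0 at other times). *)
Definition X (R : realType) (s : R) (w : cpath R) : R := 'valL_0 w s.

Definition gen_filtration (R : realType) (t : R) : set (set (cpath R)) :=
  [set A | exists s (B : set R),
    [/\ 0 <= s <= 1, s <= t, measurable B & A = X s @^-1` B]].

Definition filtration (R : realType) (t : R) : set (set (cpath R)) :=
  <<s gen_filtration t >>.

(* The same set of paths equipped with the sigma-algebra generated up to time t;
   cpath_at 1 carries the Borel sigma-algebra of C([0, 1], R). *)
Notation cpath_at t := (g_sigma_algebraType (gen_filtration t)).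

Definition law (R : realType) := probability (cpath_at (1 : R)) R.

Definition adapted (R : realType) (t : R) (Y : R -> cpath R -> R) : Prop :=
  forall s, t <= s <= 1 ->
  forall B : set R, measurable B -> filtration s (Y s @^-1` B).

Definition progressive (R : realType) (t : R)
    (nu : R -> cpath R -> R * R) : Prop :=
  forall s, t <= s <= 1 ->
  measurable_fun (`[t, s] `*` [set: cpath_at s])
    (fun z : measurableTypeR R * cpath_at s =>
       nu z.1 z.2 : measurableTypeR R * measurableTypeR R).

(* The last clause is E[Y_u | F_s] = Y_s, with the defining property of the
   conditional expectation written out. *)
Definition martingale (R : realType) (P : law R) (t : R)
    (Y : R -> cpath R -> R) : Prop :=
  [/\ adapted t Y,
      forall s, t <= s <= 1 -> P.-integrable setT (EFin \o Y s) &
      forall s u A, t <= s -> s <= u -> u <= 1 -> filtration s A ->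
        (\int[P]_(w in A) (Y u w)%:E = \int[P]_(w in A) (Y s w)%:E)%E].

Definition stopping_time (R : realType) (t : R) (sigma : cpath R -> R) : Prop :=
  (forall w, t <= sigma w <= 1) /\
  forall s, t <= s <= 1 -> filtration s [set w | sigma w <= s].

Definition local_martingale (R : realType) (P : law R) (t : R)
    (Y : R -> cpath R -> R) : Prop :=
  adapted t Y /\
  exists sigma : nat -> cpath R -> R,
    [/\ forall n, stopping_time t (sigma n),
        {ae P, forall w, forall n m, (n <= m)%N -> sigma n w <= sigma m w},
        {ae P, forall w, exists n, sigma n w = 1} &
        forall n, martingale P t
          (fun s w => Y (Num.min s (sigma n w)) w)].

Definition continuous_paths (R : realType) (P : law R) (t : R)
    (Y : R -> cpath R -> R) : Prop :=
  {ae P, forall w, {within `[t, 1], continuous (fun s => Y s w)}}.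

Definition semimartingale_decomposition (R : realType) (P : law R) (t : R)
    (Y B M : R -> cpath R -> R) : Prop :=
  [/\ [/\ adapted t B, continuous_paths P t B,
          {ae P, forall w, B t w = 0} &
          {ae P, forall w, bounded_variation t 1 (fun s => B s w)}],
      [/\ local_martingale P t M, continuous_paths P t M &
          {ae P, forall w, M t w = 0}] &
      {ae P, forall w, forall s, t <= s <= 1 ->
        Y s w = Y t w + B s w + M s w}].

(* The quadratic variation of a continuous local martingale M is the (unique up
   to indistinguishability) continuous nondecreasing adapted process A, null at
   t, such that M^2 - A is a local martingale. *)
Definition quadratic_variation (R : realType) (P : law R) (t : R)
    (M A : R -> cpath R -> R) : Prop :=
  [/\ adapted t A, continuous_paths P t A,
      {ae P, forall w, A t w = 0},
      {ae P, forall w, forall s u,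
        t <= s -> s <= u -> u <= 1 -> A s w <= A u w} &
      local_martingale P t (fun s w => M s w ^+ 2 - A s w)].

(* P belongs to P_{t,x}, with characteristics nu = (alpha, beta). *)
Definition controlled_law (R : realType) (U : set (R * R)) (t x : R)
    (P : law R) (nu : R -> cpath R -> R * R) : Prop :=
  [/\ P [set w | forall s, 0 <= s <= t -> X s w = x] = 1%E,
      progressive t nu,
      (P \x (@lebesgue_measure R))%E.-negligible
        [set z | t <= z.2 <= 1 /\ ~ U (nu z.2 z.1)] &
      exists M : R -> cpath R -> R,
        semimartingale_decomposition P t (@X R)
          (fun s w => \int[lebesgue_measure]_(r in `[t, s]) (nu r w).2) M /\
        quadratic_variation P t M
          (fun s w => \int[lebesgue_measure]_(r in `[t, s]) (nu r w).1)].

Definition exit_time (R : realType) (Rad : R) (w : cpath R) : \bar R :=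
  ereal_inf [set s%:E | s in [set s | 0 <= s <= 1 /\ ~ open_ball0 Rad (X s w)]].

(* The minimum of exit_time and 1, hence finite. *)
Definition exit_time1 (R : realType) (Rad : R) (w : cpath R) : R :=
  fine (Order.min (exit_time Rad w) 1%:E).

Definition control_cost (R : realType) (ell : R -> R -> R * R -> R) (Rad : R)
    (lam1 : R -> R) (t : R) (P : law R) (nu : R -> cpath R -> R * R) : \bar R :=
  (\int[P]_w
     (\int[lebesgue_measure]_(s in `[t, exit_time1 Rad w])
        (ell s (X s w) (nu s w))%:E
      + (lam1 (X (exit_time1 Rad w) w))%:E))%E.

(* The characteristics of P are determined dP x ds-a.e. and the cost does not
   depend on the version, so that the infimum over the pairs (P, nu) is the
   infimum over P. *)
Definition lambda (R : realType) (U : set (R * R))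
    (ell : R -> R -> R * R -> R) (Rad : R) (lam1 : R -> R) (t x : R) : \bar R :=
  ereal_inf [set c | exists P nu,
    controlled_law U t x P nu /\ c = control_cost ell Rad lam1 t P nu].

Definition lambda0_cut (R : realType) (U : set (R * R))
    (ell : R -> R -> R * R -> R) (Rad : R) (lam1 : R -> R) (x : R) : \bar R :=
  (lambda U ell Rad lam1 0 x * (\1_(open_ball0 Rad) x)%:E)%E.

Definition V (R : realType) (mu0 mu1 : probability (measurableTypeR R) R)
    (U : set (R * R)) (ell : R -> R -> R * R -> R) (K Rad : R) : \bar R :=
  ereal_sup
    [set (\int[mu0]_x lambda0_cut U ell Rad lam1 x
          - \int[mu1]_x (lam1 x * \1_(open_ball0 Rad) x)%:E)%E
    | lam1 in Lip0 K].

Definition admissible (R : realType) (U : set (R * R)) (Rad : R)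
    (l r : nat) (dt dx : R) : Prop :=
  [/\ l%:R * dt = 1, r%:R * dx = Rad &
      forall u, U u -> dt * (`|u.2| / dx + `|u.1| / dx ^+ 2) <= 1].

(* A function on the spatial grid is represented by a function of the index
   i : int, standing for the grid point x_i = i * dx; only |i| <= r matters. *)
Definition Dplus (R : realType) (dx : R) (w : int -> R) (i : int) : R :=
  (w (i + 1) - w i) / dx.

Definition Dminus (R : realType) (dx : R) (w : int -> R) (i : int) : R :=
  (w (i - 1) - w i) / dx.

Definition Dupwind (R : realType) (dx b : R) (w : int -> R) (i : int) : R :=
  Num.max 0 b * Dplus dx w i + Num.max 0 (- b) * Dminus dx w i.

Definition D2 (R : realType) (dx : R) (w : int -> R) (i : int) : R :=
  (w (i + 1) - 2 * w i + w (i - 1)) / dx ^+ 2.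

Definition scheme_step (R : realType) (U : set (R * R))
    (ell : R -> R -> R * R -> R) (dt dx t : R) (w : int -> R) (i : int) : R :=
  w i + dt * inf [set ell t (i%:~R * dx) u + Dupwind dx u.2 w i
                      + 2^-1 * u.1 * D2 dx w i | u in U].

(* Backward induction on the number n of steps left before the horizon t_l. *)
Fixpoint hat_lambda_left (R : realType) (U : set (R * R))
    (ell : R -> R -> R * R -> R) (l r : nat) (dt dx : R) (phi : int -> R)
    (n : nat) (i : int) : R :=
  if n is n'.+1 then
    if (`|i| < r)%N then
      scheme_step U ell dt dx ((l - n')%:R * dt)
        (hat_lambda_left U ell l r dt dx phi n') i
    else phi i
  else phi i.

Definition hat_lambda (R : realType) (U : set (R * R))
    (ell : R -> R -> R * R -> R) (l r : nat) (dt dx : R) (phi : int -> R)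
    (k : nat) (i : int) : R :=
  hat_lambda_left U ell l r dt dx phi (l - k) i.

Lemma hat_lambda_boundary (R : realType) (U : set (R * R))
    (ell : R -> R -> R * R -> R) (l r : nat) (dt dx : R) (phi : int -> R)
    (k : nat) (i : int) :
  k = l \/ `|i|%N = r -> hat_lambda U ell l r dt dx phi k i = phi i.
Proof.
rewrite /hat_lambda; case=> [->|ir]; first by rewrite subnn.
by case: (l - k)%N => //= n; rewrite ir ltnn.
Qed.

Lemma hat_lambda_interior (R : realType) (U : set (R * R))
    (ell : R -> R -> R * R -> R) (l r : nat) (dt dx : R) (phi : int -> R)
    (k : nat) (i : int) :
  (k < l)%N -> (`|i| < r)%N ->
  hat_lambda U ell l r dt dx phi k i =
  scheme_step U ell dt dx (k.+1%:R * dt)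
    (hat_lambda U ell l r dt dx phi k.+1) i.
Proof.
move=> kl ir; rewrite /hat_lambda.
have -> : (l - k = (l - k.+1).+1)%N by rewrite -subSn // subSS.
by rewrite /= ir subKn.
Qed.

Definition lin (R : realType) (Rad dx : R) (phi : int -> R) (x : R) : R :=
  if x \in `]- Rad, Rad[ then
    let i := Num.floor (x / dx) in
    phi i + (phi (i + 1) - phi i) * (x / dx - i%:~R)
  else 0.

Definition grid_restr (R : realType) (dx : R) (lam1 : R -> R) (i : int) : R :=
  lam1 (i%:~R * dx).

Definition LipR0 (R : realType) (K : R) (r : nat) (dx : R) : set (int -> R) :=
  [set phi | exists2 lam1, Lip0 K lam1 &
    forall i : int, (`|i| <= r)%N -> phi i = grid_restr dx lam1 i].

Definition Vh (R : realType) (mu0 mu1 : probability (measurableTypeR R) R)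
    (U : set (R * R)) (ell : R -> R -> R * R -> R) (K Rad : R)
    (l r : nat) (dt dx : R) : \bar R :=
  ereal_sup
    [set (\int[mu0]_x (lin Rad dx (hat_lambda U ell l r dt dx phi 0) x)%:E
          - \int[mu1]_x (lin Rad dx phi x)%:E)%E
    | phi in LipR0 K r dx].

(* Main.v *)
Require Import Defs.
From HB Require Import structures.
From mathcomp Require Import all_boot all_order all_algebra.
From mathcomp Require Import all_classical all_reals all_analysis.
From mathcomp Require Import measurable_realfun ring lra zify.

Set Implicit Arguments.
Unset Strict Implicit.
Unset Printing Implicit Defensive.

Import Order.TTheory GRing.Theory Num.Theory.
Import numFieldNormedType.Exports.

Local Open Scope classical_set_scope.
Local Open Scope ring_scope.

(** Both values are suprema over the same terminal data lam1: a datum on the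
grid is the restriction of some lam1 in Lip0 K, and neither the scheme nor its
interpolation looks at indices beyond r. Hence it suffices to compare the two
functionals at a fixed lam1, since taking suprema is 1-Lipschitz for the
uniform distance.

The functionals differ by two errors. On the side of mu0 it is the integral of
the scheme error, bounded by the convergence hypothesis. On the side of mu1 it
is the error of piecewise linear interpolation: inside a cell, lin is a convex
combination of the values of lam1 at the two endpoints, each at distance at
most dx of the current point, so a K-Lipschitz function is moved by at most
K * dx ([lin_grid_restr_dist]).

With extended reals a further point is needed: the difference of two infinite
suprema is infinite, so the suprema must be shown finite before they are
subtracted. A datum in Lip0 K is bounded by K * Rad on the grid because it
vanishes at 0, and each of the finitely many steps of the scheme turns a
uniform bound into a uniform bound, since controls and costs are bounded by
compactness ([hat_lambda_left_bounded]). This bounds the discrete functional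
uniformly in lam1, and the continuous one inherits finiteness through the
comparison ([ereal_sup_dist]). *)

(** * Distances between suprema and infima *)

(** The bound on f is what makes the conclusion meaningful: were both suprema
+oo, their difference would be infinite. Being within c of f, the function g
inherits the bound. *)
Lemma ereal_sup_dist (R : realType) (T : Type) (S : set T) (f g : T -> \bar R)
    (M c : R) :
  S !=set0 -> (forall s, S s -> `|f s| <= M%:E)%E ->
  (forall s, S s -> `|f s - g s| <= c%:E)%E ->
  (`|ereal_sup (f @` S) - ereal_sup (g @` S)| <= c%:E)%E.
Proof.
move=> [s0 Ss0] fM fgc.
have near s : S s -> exists a b : R,
    [/\ f s = a%:E, g s = b%:E, `|a| <= M & `|a - b| <= c].
  move=> Ss; move: (fM _ Ss) (fgc _ Ss).
  case: (f s) => [a| |] //; case: (g s) => [b| |] //=.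
  by rewrite !lee_fin; exists a, b.
have [a0 [b0 [fa0 gb0 _ _]]] := near _ Ss0.
have fleM : (ereal_sup (f @` S) <= M%:E)%E.
  apply: ge_ereal_sup => _ [s Ss <-]; have [a [b [-> _ aM _]]] := near _ Ss.
  by rewrite lee_fin (le_trans (ler_norm _)).
have lef : (a0%:E <= ereal_sup (f @` S))%E.
  by apply: ereal_sup_ubound; exists s0.
have leg : (b0%:E <= ereal_sup (g @` S))%E.
  by apply: ereal_sup_ubound; exists s0.
have gf : (ereal_sup (g @` S) <= ereal_sup (f @` S) + c%:E)%E.
  apply: ge_ereal_sup => _ [s Ss <-]; have [a [b [fa -> _ ab]]] := near _ Ss.
  have : (a%:E <= ereal_sup (f @` S))%E by apply: ereal_sup_ubound; exists s.
  move=> /(leeD2r c%:E); apply: le_trans.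
  by rewrite -EFinD lee_fin; move: ab; rewrite ler_norml; lra.
have fg : (ereal_sup (f @` S) <= ereal_sup (g @` S) + c%:E)%E.
  apply: ge_ereal_sup => _ [s Ss <-]; have [a [b [-> gb _ ab]]] := near _ Ss.
  have : (b%:E <= ereal_sup (g @` S))%E by apply: ereal_sup_ubound; exists s.
  move=> /(leeD2r c%:E); apply: le_trans.
  by rewrite -EFinD lee_fin; move: ab; rewrite ler_norml; lra.
move: fleM lef leg gf fg.
case: (ereal_sup (f @` S)) => [x| |] //; case: (ereal_sup (g @` S)) => [y| |] //.
move=> _ _ _ xy yx; apply: (_ : ((`|x - y|)%:E <= c%:E)%E).
by move: xy yx; rewrite -!EFinD !lee_fin ler_norml; lra.
Qed.

(** The assumption 0 <= M covers the empty set, whose infimum is 0. *)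
Lemma normr_inf_le (R : realType) (S : set R) (M : R) :
  0 <= M -> (forall x, S x -> `|x| <= M) -> `|inf S| <= M.
Proof.
move=> M0 SM.
have [->|/set0P[x Sx]] := eqVneq S set0; first by rewrite inf0 normr0.
have lbM : lbound S (- M).
  by move=> y /SM; rewrite ler_norml => /andP[].
rewrite ler_norml; apply/andP; split; first by apply: lb_le_inf => //; exists x.
apply: (@le_trans _ _ x); first by apply: ge_inf => //; exists (- M).
by rewrite (le_trans (ler_norm _))// SM.
Qed.

(** * Piecewise linear interpolation *)

(** On each of the countably many sets where the integer part of g is constant,
the function agrees with one of the measurable F i. *)
Lemma measurable_floor_select (R : realType) (g : R -> R) (F : int -> R -> R) :
  measurable_fun setT g -> (forall i, measurable_fun setT (F i)) ->
  measurable_fun setT (fun x => F (Num.floor (g x)) x).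
Proof.
move=> mg mF _ B mB; rewrite setTI.
have -> : (fun x => F (Num.floor (g x)) x) @^-1` B =
    \bigcup_(i in [set: int]) (g @^-1` `[i%:~R, (i + 1)%:~R[ `&` F i @^-1` B).
  apply/seteqP; split=> [x /= Bx|x [i _ [/=]]].
    exists (Num.floor (g x)) => //; split => //=.
    by rewrite in_itv /= floor_itv.
  by rewrite in_itv /= => /floor_def <-.
apply: countable_bigcupT_measurable => // i; apply: measurableI.
  by rewrite -[X in measurable X]setTI; apply: mg => //; exact: measurable_itv.
by rewrite -[X in measurable X]setTI; apply: mF.
Qed.

Lemma measurable_lin (R : realType) (Rad dx : R) (phi : int -> R) :
  measurable_fun setT (lin Rad dx phi : measurableTypeR R -> measurableTypeR R).
Proof.
rewrite /lin; apply: measurable_fun_ifT => /=.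
- apply: (measurable_fun_bool true); rewrite setTI.
  rewrite (_ : _ @^-1` _ = `]- Rad, Rad[%classic); first exact: measurable_itv.
  by apply/seteqP; split=> x /=; rewrite in_itv.
- pose F i (x : R) := phi i + (phi (i + 1) - phi i) * (x / dx - i%:~R).
  apply: (@measurable_floor_select R (fun x => x / dx) F).
    exact: mulrr_measurable.
  move=> i; apply: measurable_funD => //; apply: measurable_funM => //.
  by apply: measurable_funB => //; exact: mulrr_measurable.
- exact: measurable_cst.
Qed.

(** The common source of all estimates on lin: at a point of the open ball it
is an average of two grid values whose indices stay within the grid. The upper
index is at most r because the ball is open on the right. *)
Lemma lin_convex_comb (R : realType) (Rad dx : R) (r : nat) (x : R) :
  0 < dx -> r%:R * dx = Rad -> x \in `]- Rad, Rad[ ->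
  exists (i : int) (p : R),
    [/\ (`|i| <= r)%N /\ (`|(i + 1)%R| <= r)%N, 0 <= p <= 1,
        x = (1 - p) * (i%:~R * dx) + p * ((i + 1)%:~R * dx) &
        forall phi, lin Rad dx phi x = (1 - p) * phi i + p * phi (i + 1)].
Proof.
move=> dx0 rdx xI; have := xI; rewrite in_itv /= => /andP[xl xr].
have /andP[fl fr] := floor_itv (x / dx).
set i := Num.floor (x / dx) in fl fr *.
have ir : i < r%:Z.
  rewrite -(@ltr_int R); apply: le_lt_trans fl _.
  by rewrite ltr_pdivrMr// -pmulrn rdx.
have il : - r%:Z <= i.
  by rewrite floor_ge_int ler_pdivlMr// mulrNz mulNr -pmulrn rdx ltW.
exists i, (x / dx - i%:~R); split.
- by lia.
- by rewrite rmorphD /= in fr; apply/andP; split; lra.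
- by rewrite rmorphD /=; field; rewrite gt_eqF.
- by move=> phi; rewrite /lin xI -/i; ring.
Qed.

Lemma lin_eq (R : realType) (Rad dx : R) (r : nat) (phi psi : int -> R) :
  0 < dx -> r%:R * dx = Rad -> (forall i, (`|i| <= r)%N -> phi i = psi i) ->
  lin Rad dx phi = lin Rad dx psi.
Proof.
move=> dx0 rdx eq; apply/funext => x.
have [xI|/negbTE xI] := boolP (x \in `]- Rad, Rad[); last by rewrite /lin xI.
have [i [p [[ir jr] _ _ E]]] := lin_convex_comb dx0 rdx xI.
by rewrite !E !eq.
Qed.

Lemma normr_lin_le (R : realType) (Rad dx : R) (r : nat) (phi : int -> R)
    (M x : R) :
  0 < dx -> r%:R * dx = Rad -> 0 <= M ->
  (forall i, (`|i| <= r)%N -> `|phi i| <= M) -> `|lin Rad dx phi x| <= M.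
Proof.
move=> dx0 rdx M0 phiM.
have [xI|/negbTE xI] := boolP (x \in `]- Rad, Rad[); last first.
  by rewrite /lin xI normr0.
have [i [p [[/phiM ir /phiM jr] p01 _ ->]]] := lin_convex_comb dx0 rdx xI.
by move: ir jr; rewrite !ler_norml; nra.
Qed.

(** The function and its interpolation both vanish off the ball; on it, the two
values averaged by lin are taken within distance dx of x. *)
Lemma lin_grid_restr_dist (R : realType) (K Rad dx : R) (r : nat)
    (lam : R -> R) (x : R) :
  0 < K -> 0 < dx -> r%:R * dx = Rad -> Lip0 K lam ->
  `|lin Rad dx (grid_restr dx lam) x - lam x * \1_(open_ball0 Rad) x|
  <= K * dx.
Proof.
move=> K0 dx0 rdx [_ lip _]; rewrite indicE /open_ball0.
have Kdx : 0 <= K * dx by rewrite mulr_ge0 ?ltW.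
have [xI|/negbTE xI] := boolP (x \in `]- Rad, Rad[); last first.
  rewrite /lin xI memNset ?mulr0 ?subr0 ?normr0//=; first by rewrite xI.
rewrite mem_set//= mulr1.
have [i [p [_ /andP[p0 p1] xE ->]]] := lin_convex_comb dx0 rdx xI.
have iE : (i + 1)%:~R = i%:~R + 1 :> R by rewrite rmorphD.
have lo : `|lam (i%:~R * dx) - lam x| <= K * dx.
  apply: le_trans (lip _ _) _; rewrite ler_pM2l// xE iE ler_norml; nra.
have hi : `|lam ((i + 1)%:~R * dx) - lam x| <= K * dx.
  apply: le_trans (lip _ _) _; rewrite ler_pM2l// xE iE ler_norml; nra.
move: lo hi; rewrite /grid_restr !ler_norml; nra.
Qed.

(** * Terminal data *)

Lemma grid_restr_le (R : realType) (K Rad dx : R) (r : nat) (lam : R -> R)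
    (i : int) :
  0 < K -> 0 < dx -> r%:R * dx = Rad -> Lip0 K lam -> (`|i| <= r)%N ->
  `|grid_restr dx lam i| <= K * Rad.
Proof.
move=> K0 dx0 rdx [_ lip lam0] ir; rewrite /grid_restr.
have := lip (i%:~R * dx) 0; rewrite lam0 !subr0 => /le_trans; apply.
rewrite ler_pM2l// -rdx normrM (gtr0_norm dx0) ler_pM2r//.
by rewrite -intr_norm -abszE -pmulrn ler_nat.
Qed.

Lemma Lip0_continuous (R : realType) (K : R) (lam : R -> R) :
  0 < K -> Lip0 K lam -> continuous lam.
Proof.
move=> K0 [_ lip _] x; apply/cvgrPdist_le => e e0.
near=> y; apply: le_trans (lip _ _) _; rewrite mulrC -ler_pdivlMr//.
near: y; apply: cvgr_dist_le; first exact: cvg_id.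
by rewrite divr_gt0.
Unshelve. all: by end_near. Qed.

(** * Uniform bounds for the scheme *)

Lemma control_set_bounded (R : realType) (U : set (R * R)) :
  control_set U ->
  exists2 B : R, 0 <= B & forall u, U u -> `|u.1| <= B /\ `|u.2| <= B.
Proof.
move=> [/compact_bounded [N [_ N1]] _ _].
exists (`|N| + 1) => [|u Uu]; first by rewrite addr_ge0.
have := N1 (`|N| + 1) (ltr_pwDr ltr01 (ler_norm _)) _ Uu.
by rewrite /Num.norm /= ge_max => /andP[].
Qed.

Lemma running_cost_bounded (R : realType) (U : set (R * R))
    (ell : R -> R -> R * R -> R) (Rad : R) :
  control_set U -> running_cost U ell ->
  exists2 E : R, 0 <= E & forall t x u, 0 <= t <= 1 -> `|x| <= Rad -> U u ->
    `|ell t x u| <= E.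
Proof.
move=> [cU _ _] [_ ctn _ _].
pose A : set (R * R * (R * R)) := `[0, 1] `*` `[- Rad, Rad] `*` U.
have cA : compact A.
  by apply: compact_setX => //; apply: compact_setX; exact: segment_compact.
have sA : A `<=` `[0, 1] `*` setT `*` U by move=> z [[]].
have [N [_ N1]] := compact_bounded
  (continuous_compact (continuous_subspaceW sA ctn) cA).
exists (`|N| + 1) => [|t x u t01 xR Uu]; first by rewrite addr_ge0.
apply: (N1 (`|N| + 1) (ltr_pwDr ltr01 (ler_norm _))).
by exists (t, x, u) => //; split => //; split; rewrite /= in_itv//= -ler_norml.
Qed.

Lemma admissible_gt0 (R : realType) (U : set (R * R)) (Rad : R) (l r : nat)
    (dt dx : R) :
  0 < Rad -> admissible U Rad l r dt dx -> 0 < dt /\ 0 < dx.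
Proof.
move=> Rad0 [ldt rdx _]; split.
  have : 0 < l%:R * dt by rewrite ldt.
  by case: l {ldt} => [|l]; rewrite ?mul0r ?ltxx// pmulr_rgt0.
have : 0 < r%:R * dx by rewrite rdx.
by case: r {rdx} => [|r]; rewrite ?mul0r ?ltxx// pmulr_rgt0.
Qed.

(** The scheme never reads its datum outside the grid: a step is taken at
interior indices only, and reaches just the two neighbours. *)
Lemma hat_lambda_left_ext (R : realType) (U : set (R * R))
    (ell : R -> R -> R * R -> R) (l r : nat) (dt dx : R) (phi psi : int -> R)
    (n : nat) (i : int) :
  (forall i, (`|i| <= r)%N -> phi i = psi i) -> (`|i| <= r)%N ->
  hat_lambda_left U ell l r dt dx phi n i =
  hat_lambda_left U ell l r dt dx psi n i.
Proof.
move=> eq; elim: n i => [|n IH] i ir /=; first exact: eq.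
case: ifPn => ilr; last exact: eq.
have jr : (`|(i + 1)%R| <= r)%N by lia.
have kr : (`|(i - 1)%R| <= r)%N by lia.
by rewrite /scheme_step /Dupwind /Dplus /Dminus /D2 !IH.
Qed.

(** A difference of two values of w is at most 2 * M and a second difference at
most 4 * M, so the expression minimised over U is bounded uniformly in the
control, and so is its infimum. *)
Lemma scheme_step_bounded (R : realType) (U : set (R * R))
    (ell : R -> R -> R * R -> R) (dt dx t B E M : R) (w : int -> R) (i : int) :
  0 < dt -> 0 < dx -> 0 <= B -> 0 <= E -> 0 <= M ->
  (forall u, U u -> `|u.1| <= B /\ `|u.2| <= B) ->
  (forall u, U u -> `|ell t (i%:~R * dx) u| <= E) ->
  `|w i| <= M -> `|w (i + 1)| <= M -> `|w (i - 1)| <= M ->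
  `|scheme_step U ell dt dx t w i| <=
    M + dt * (E + (B * (2 * M / dx) + B * (2 * M / dx)) + B * (4 * M / dx ^+ 2)).
Proof.
move=> dt0 dx0 B0 E0 M0 UB UE wi wj wk; rewrite /scheme_step.
apply: le_trans (ler_normD _ _) _; apply: lerD => //.
rewrite normrM (gtr0_norm dt0) ler_pM2l//.
have bnd1 : 0 <= 2 * M / dx by rewrite divr_ge0 ?mulr_ge0// ltW.
have bnd2 : 0 <= 4 * M / dx ^+ 2 by rewrite divr_ge0 ?mulr_ge0 ?exprn_ge0// ltW.
apply: normr_inf_le => [|_ [u Uu <-]].
  by rewrite !addr_ge0// mulr_ge0.
have [u1 u2] := UB _ Uu; have eE := UE _ Uu.
have diff a b : `|a| <= M -> `|b| <= M -> `|(a - b) / dx| <= 2 * M / dx.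
  move=> aM bM; rewrite normrM normfV (gtr0_norm dx0) ler_pM2r ?invr_gt0//.
  by apply: le_trans (ler_normB _ _) _; rewrite mulr_natl mulr2n lerD.
have D2M : `|D2 dx w i| <= 4 * M / dx ^+ 2.
  rewrite /D2 normrM normfV (ger0_norm (sqr_ge0 _)).
  rewrite ler_pM2r ?invr_gt0 ?exprn_gt0//.
  by move: wi wj wk; rewrite !ler_norml; lra.
have max_le b : `|b| <= B -> `|Num.max 0 b| <= B.
  by move=> bB; case: (leP 0 b) => _; rewrite ?normr0.
apply: le_trans (ler_normD _ _) _; apply: lerD; last first.
  rewrite normrM; apply: ler_pM => //.
  rewrite normrM ger0_norm//; move: u1; have := normr_ge0 u.1; lra.
apply: le_trans (ler_normD _ _) _; apply: lerD => //.
rewrite /Dupwind /Dplus /Dminus; apply: le_trans (ler_normD _ _) _.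
apply: lerD; rewrite normrM; apply: ler_pM => //; try exact: diff.
  exact: max_le.
by apply: max_le; rewrite normrN.
Qed.

(** What matters is that M does not depend on phi, so that the discrete
functional is bounded over all terminal data at once. The constant may grow
with n, as only finitely many steps are made. *)
Lemma hat_lambda_left_bounded (R : realType) (U : set (R * R))
    (ell : R -> R -> R * R -> R) (Rad dt dx C : R) (l r n : nat) :
  control_set U -> running_cost U ell -> 0 < Rad ->
  admissible U Rad l r dt dx -> 0 <= C ->
  exists2 M : R, 0 <= M & forall phi : int -> R,
    (forall i, (`|i| <= r)%N -> `|phi i| <= C) ->
    forall i, (`|i| <= r)%N ->
      `|hat_lambda_left U ell l r dt dx phi n i| <= M.
Proof.
move=> hU hell Rad0 hh C0.
have [dt0 dx0] := admissible_gt0 Rad0 hh; have [ldt rdx _] := hh.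
have [B B0 UB] := control_set_bounded hU.
have [E E0 UE] := running_cost_bounded Rad hU hell.
elim: n => [|n [M M0 IH]]; first by exists C.
(* The boundary values stay below C, the interior ones below S. *)
set S := M + dt * (E + (B * (2 * M / dx) + B * (2 * M / dx))
                     + B * (4 * M / dx ^+ 2)).
have S0 : 0 <= S.
  by rewrite !(addr_ge0, mulr_ge0, invr_ge0, exprn_ge0)// ltW.
exists (C + S) => [|phi phiC i ir /=]; first by rewrite addr_ge0.
case: ifPn => ilr; last by rewrite (le_trans (phiC _ ir))// lerDl.
apply: (@le_trans _ _ S); last by rewrite lerDr.
apply: scheme_step_bounded => //.
- move=> u Uu; apply: UE => //.
    apply/andP; split; first by rewrite mulr_ge0// ltW.
    by rewrite -[leRHS]ldt ler_pM2r// ler_nat leq_subr.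
  rewrite normrM (gtr0_norm dx0) -rdx ler_pM2r//.
  by rewrite -intr_norm -abszE -pmulrn ler_nat.
- exact: IH.
- by apply: IH => //; lia.
- by apply: IH => //; lia.
Qed.

(** * Comparison of the two values *)

Lemma integrable_bounded (R : realType)
    (mu : probability (measurableTypeR R) R) (f : R -> R) (M : R) :
  measurable_fun setT (f : measurableTypeR R -> measurableTypeR R) ->
  (forall x, `|f x| <= M) ->
  mu.-integrable setT (fun x : measurableTypeR R => (f x)%:E) /\
  exists2 a : R, (\int[mu]_x (f x)%:E = a%:E)%E & `|a| <= M.
Proof.
move=> mf fM.
have mEf : measurable_fun setT (fun x : measurableTypeR R => (f x)%:E).
  exact/measurable_EFinP.
split.
  apply: measurable_bounded_integrable => //.
    by apply: le_lt_trans (probability_le1 mu measurableT) _; rewrite ltry.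
  exists M; split; first exact: num_real.
  by move=> y My x _ /=; rewrite (le_trans (fM x))// ltW.
suff: (`|\int[mu]_x (f x)%:E| <= M%:E)%E.
  case: (\int[mu]_x (f x)%:E)%E => [a| |]//=.
  by rewrite lee_fin; exists a.
apply: le_trans (le_abse_integral mu measurableT mEf) _.
apply: (@le_trans _ _ (\int[mu]_x (cst M%:E x))%E).
  apply: ge0_le_integral => //.
  - exact: measurableT_comp.
  - by move=> x _ /=; rewrite lee_fin.
rewrite (integral_cst mu (D := setT) measurableT M%:E).
have M0 : 0 <= M := le_trans (normr_ge0 (f 0)) (fM 0).
rewrite -[leRHS]mule1; apply: lee_wpmul2l; first by rewrite lee_fin.
exact: probability_le1.
Qed.

Theorem theorem5p3 (R : realType)
    (mu0 mu1 : probability (measurableTypeR R) R)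
    (U : set (R * R)) (ell : R -> R -> R * R -> R)
    (hU : control_set U) (hell : running_cost U ell)
    (K Rad : R) (hK : 0 < K) (hRad : 0 < Rad)
    (L rho1 rho2 : R) (hL : 0 < L) (hrho1 : 0 < rho1) (hrho2 : 0 < rho2)
    (hconv : forall (l r : nat) (dt dx : R), admissible U Rad l r dt dx ->
      forall lam1 : R -> R, Lip0 K lam1 ->
      let err := fun x : measurableTypeR R =>
        ((lin Rad dx (hat_lambda U ell l r dt dx (grid_restr dx lam1) 0) x)%:E
         - lambda0_cut U ell Rad lam1 x)%E in
      mu0.-integrable setT err /\
      (\int[mu0]_x `|err x| <= (L * (dt `^ rho1 + dx `^ rho2))%:E)%E)
    (l r : nat) (dt dx : R) (hh : admissible U Rad l r dt dx) :
  (`| Vh mu0 mu1 U ell K Rad l r dt dx - V mu0 mu1 U ell K Rad |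
   <= (L * (dt `^ rho1 + dx `^ rho2) + K * dx)%:E)%E.
Proof.
have [dt0 dx0] := admissible_gt0 hRad hh; have [_ rdx _] := hh.
pose hat phi := hat_lambda U ell l r dt dx phi 0.
pose Jh (lam : R -> R) : \bar R :=
  (\int[mu0]_x (lin Rad dx (hat (grid_restr dx lam)) x)%:E
   - \int[mu1]_x (lin Rad dx (grid_restr dx lam) x)%:E)%E.
have -> : Vh mu0 mu1 U ell K Rad l r dt dx = ereal_sup (Jh @` Lip0 K).
  congr ereal_sup.
  (* A discrete datum phi agrees with some lam only at the indices |i| <= r. *)
  apply/seteqP; split=> z [].
    move=> phi [lam Llam eq] <-; exists lam => //; rewrite /Jh.
    rewrite (lin_eq dx0 rdx eq) -/(hat phi).
    suff -> : lin Rad dx (hat phi) = lin Rad dx (hat (grid_restr dx lam)) by [].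
    by apply: (lin_eq dx0 rdx) => i ir; exact: hat_lambda_left_ext.
  by move=> lam Llam <-; exists (grid_restr dx lam) => //; exists lam.
have KR0 : 0 <= K * Rad by rewrite mulr_ge0// ltW.
have [M M0 hatM] :=
  hat_lambda_left_bounded (l - 0) hU hell hRad hh KR0.
have linJ lam : Lip0 K lam -> exists a b : R,
    [/\ mu0.-integrable setT (fun x : measurableTypeR R =>
          (lin Rad dx (hat (grid_restr dx lam)) x)%:E) /\
        mu1.-integrable setT (fun x : measurableTypeR R =>
          (lin Rad dx (grid_restr dx lam) x)%:E),
        (\int[mu0]_x (lin Rad dx (hat (grid_restr dx lam)) x)%:E = a%:E)%E,
        (\int[mu1]_x (lin Rad dx (grid_restr dx lam) x)%:E = b%:E)%E,
        `|a| <= M & `|b| <= K * Rad].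
  move=> Llam.
  have [|intA [a Ea aM]] := @integrable_bounded _ mu0 _ M
      (measurable_lin Rad dx (hat (grid_restr dx lam))).
    move=> x; apply: (normr_lin_le x dx0 rdx M0) => i ir.
    by apply: hatM => // j; exact: (grid_restr_le hK dx0 rdx Llam).
  have [|intl [b Eb bM]] := @integrable_bounded _ mu1 _ (K * Rad)
      (measurable_lin Rad dx (grid_restr dx lam)).
    move=> x; apply: (normr_lin_le x dx0 rdx KR0) => i ir.
    exact: (grid_restr_le hK dx0 rdx Llam).
  by exists a, b.
apply: (@ereal_sup_dist _ _ _ _ _ (M + K * Rad)).
- exists (cst 0); split => //.
  + by exists 0; split; [exact: num_real|
      move=> y y0 x _ /=; rewrite normr0 ltW].
  + by move=> x y; rewrite subrr normr0 mulr_ge0// ltW.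
- move=> lam /linJ [a [b [_ Ea Eb aM bK]]]; rewrite /Jh Ea Eb.
  apply: (_ : ((`|a - b|)%:E <= _)%E); rewrite lee_fin.
  by rewrite (le_trans (ler_normB _ _))// lerD.
move=> lam Llam; have [a [b [[intA intl] Ea Eb _ _]]] := linJ _ Llam.
have [interr lerr] := hconv _ _ _ _ hh _ Llam.
set err := fun x => _ in interr lerr.
have [e Ee eL] : exists2 e : R, (\int[mu0]_x err x = e%:E)%E &
    `|e| <= L * (dt `^ rho1 + dx `^ rho2).
  have := le_trans (le_abse_integral mu0 measurableT
    (measurable_int mu0 interr)) lerr.
  by case: (\int[mu0]_x err x)%E => [e| |]//=; rewrite lee_fin; exists e.
(* As the discrete value is finite, lambda0_cut is the discrete value minus the
   error even where it is infinite; this is how it gets its integral. *)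
have cutE : (\int[mu0]_x lambda0_cut U ell Rad lam x = (a - e)%:E)%E.
  rewrite EFinB -Ea -Ee -(integralB measurableT intA interr).
  apply: eq_integral => x _; rewrite /err /hat.
  by case: (lambda0_cut _ _ _ _ _) => [y| |]//=; congr EFin; ring.
set cut1 := fun x : R => lam x * \1_(open_ball0 Rad) x.
have mcut1 : measurable_fun setT
    (cut1 : measurableTypeR R -> measurableTypeR R).
  apply: measurable_funM.
    by apply: continuous_measurable_fun; exact: Lip0_continuous Llam.
  by apply: measurable_indic; exact: measurable_itv.
have distE x := lin_grid_restr_dist x hK dx0 rdx Llam.
have [|intc [b' Eb' _]] := @integrable_bounded _ mu1 _ (K * Rad + K * dx) mcut1.
  move=> x; have := distE x.
  have : `|lin Rad dx (grid_restr dx lam) x| <= K * Rad.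
    by apply: (normr_lin_le x dx0 rdx KR0) => i ir;
      exact: (grid_restr_le hK dx0 rdx Llam).
  by rewrite /cut1 !ler_norml; lra.
have [|_ [d Ed dK]] := @integrable_bounded _ mu1
  (fun x => lin Rad dx (grid_restr dx lam) x - cut1 x) (K * dx) _ distE.
  by apply: measurable_funB => //; exact: measurable_lin.
have dE : d = b - b'.
  apply: EFin_inj; rewrite -Ed EFinB -Eb -Eb'.
  exact: (integralB_EFin measurableT intl intc).
rewrite /Jh Ea Eb cutE Eb'; apply: (_ : ((`|a - b - (a - e - b')|)%:E <= _)%E).
rewrite lee_fin; move: eL dK; rewrite dE !ler_norml; lra.
Qed.
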